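(* Let $n\ge 2$, let $E\subseteq\mathbb{R}^n$ be given, and let $F$ denote the union of $E$ with every (affine) $(n-1)$-plane in $\mathbb{R}^n$ that intersects $E$ in a set of Hausdorff dimension $n-1$. Then $$\dim_P(F)=\dim_P(E).$$
   Context: $\dim_P$ denotes packing dimension. *)

(* Defs.v *)
From HB Require Import structures.
From mathcomp Require Import all_boot all_order all_algebra.
From mathcomp Require Import all_classical all_reals all_analysis.

Set Implicit Arguments.
Unset Strict Implicit.
Unset Printing Implicit Defensive.

Import Order.TTheory GRing.Theory Num.Theory.

Local Open Scope classical_set_scope.
Local Open Scope ring_scope.

(* The library's norm on 'rV[R]_n is the sup norm, so the Euclidean distance
   is introduced here. *)
Definition eucl_dist (R : realType) (n : nat) (x y : 'rV[R]_n) : R :=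
  Num.sqrt (\sum_(i < n) (x 0 i - y 0 i) ^+ 2).

Definition closed_eball (R : realType) (n : nat) (c : 'rV[R]_n) (r : R) :
    set 'rV[R]_n :=
  [set y | eucl_dist c y <= r].

Definition affine_plane (R : realType) (n k : nat) (H : set 'rV[R]_n) : Prop :=
  exists (p : 'rV[R]_n) (V : {vspace 'rV[R]_n}),
    \dim V = k /\ H = [set p + v | v in [set v | v \in V]].

Local Open Scope ereal_scope.

(* diam set0 = -oo *)
Definition diam (R : realType) (n : nat) (U : set 'rV[R]_n) : \bar R :=
  ereal_sup [set (eucl_dist x y)%:E | x in U & y in U].

(* Infimum over the finite or countable covers (U i)_(i in D) of A by sets of
   diameter at most delta.  As 0 `^ 0 = 1, a singleton contributes 1 for s = 0;
   as -oo `^ s = 0 for s != 0, an empty U i contributes 0 for s > 0, and for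
   s = 0 it can be removed from the cover by shrinking D. *)
Definition hausdorff_premeasure (R : realType) (n : nat) (s delta : R)
    (A : set 'rV[R]_n) : \bar R :=
  ereal_inf [set m | exists (D : set nat) (U : nat -> set 'rV[R]_n),
    [/\ A `<=` \bigcup_(i in D) U i,
        forall i, D i -> diam (U i) <= delta%:E
      & m = \esum_(i in D) (diam (U i) `^ s)]].

Definition hausdorff_measure (R : realType) (n : nat) (s : R)
    (A : set 'rV[R]_n) : \bar R :=
  ereal_sup [set hausdorff_premeasure s delta A
            | delta in [set delta : R | (0 < delta)%R]].

Definition hausdorff_dim (R : realType) (n : nat) (A : set 'rV[R]_n) : \bar R :=
  ereal_inf [set s%:E | s in
    [set s : R | (0 <= s)%R /\ hausdorff_measure s A = 0]].

(* Supremum over the finite or countable families (indexed by D) of pairwise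
   disjoint closed balls centred in A with radii at most delta. *)
Definition packing_delta (R : realType) (n : nat) (s delta : R)
    (A : set 'rV[R]_n) : \bar R :=
  ereal_sup [set m | exists (D : set nat) (c : nat -> 'rV[R]_n) (r : nat -> R),
    [/\ forall i, D i -> A (c i) /\ (0 < r i <= delta)%R,
        trivIset D (fun i => closed_eball (c i) (r i))
      & m = \esum_(i in D) ((2 * r i) `^ s)%:E]].

(* packing_delta is nondecreasing in delta, so this infimum is its limit as
   delta tends to 0. *)
Definition packing_premeasure (R : realType) (n : nat) (s : R)
    (A : set 'rV[R]_n) : \bar R :=
  ereal_inf [set packing_delta s delta A
            | delta in [set delta : R | (0 < delta)%R]].

(* packing_premeasure is not countably subadditive; the packing measure is the
   outer measure obtained from it through countable covers. *)
Definition packing_measure (R : realType) (n : nat) (s : R)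
    (A : set 'rV[R]_n) : \bar R :=
  ereal_inf [set m | exists B : nat -> set 'rV[R]_n,
    A `<=` \bigcup_i B i /\ m = \esum_(i in [set: nat]) packing_premeasure s (B i)].

Definition packing_dim (R : realType) (n : nat) (A : set 'rV[R]_n) : \bar R :=
  ereal_inf [set s%:E | s in
    [set s : R | (0 <= s)%R /\ packing_measure s A = 0]].

Definition plane_extension (R : realType) (n : nat) (E : set 'rV[R]_n) :
    set 'rV[R]_n :=
  E `|` \bigcup_(H in [set H | affine_plane n.-1 H /\
                              hausdorff_dim (E `&` H) = n.-1%:R%:E]) H.

(* Main.v *)
(* The upper bound is Cordoba's L^2 argument, discretised.  A set E of packing
   measure zero in dimension s is covered by countably many sets B whose
   2^-k-covering numbers are O(2^(ks)).  If dim_H (E `&` H) = n - 1 then, by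
   countable stability, for one of these B the slice B `&` H meets at least
   c 2^(k(n-1-e)) dyadic cells at every scale k >= m.  Fix B, c and m, and choose
   one such plane H_j through each of the N cells met by the union of these
   planes; let Y_j be the set of cells met by B `&` H_j.  If the point chosen for
   H_i is at distance D from H_j, in units of the cell side, then Y_i and Y_j
   share O(2^(k(n-1)) / (1 + D)) cells, and summing over the points gives only a
   logarithmic loss.  Cauchy-Schwarz then bounds N by O(2^(k(s+3e))), and
   covering numbers control the packing premeasure in any larger dimension. *)

Require Import Defs.
From mathcomp Require Import all_boot all_order all_algebra.
From mathcomp Require Import all_classical all_reals all_analysis.
From mathcomp Require Import ring lra zify.

Set Implicit Arguments.
Unset Strict Implicit.
Unset Printing Implicit Defensive.

Import Order.TTheory GRing.Theory Num.Theory.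

Local Open Scope classical_set_scope.
Local Open Scope ring_scope.

(** * Counting lattice points in slabs *)

(** Projection along the coordinate [i]: overwriting it by [z] keeps the image in the same type, so
    projections can be iterated. *)
Definition erase (n : nat) (T : finType) (z : T) (i : 'I_n)
    (q : {ffun 'I_n -> T}) : {ffun 'I_n -> T} :=
  [ffun j => if j == i then z else q j].

Definition dot (R : realType) (n K : nat) (u : 'I_n -> R)
    (q : {ffun 'I_n -> 'I_K}) : R :=
  \sum_(j < n) u j * (q j)%:R.

Lemma card_le_fiber (R : numDomainType) (S T : finType) (f : S -> T)
    (A : {set S}) (B : {set T}) (L : R) :
  (forall x, x \in A -> f x \in B) ->
  (forall y, y \in B -> #|[set x in A | f x == y]%SET|%:R <= L) ->
  #|A|%:R <= L * #|B|%:R.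
Proof.
move=> fAB fL; rewrite -sum1_card (partition_big f (mem B)) //= natr_sum.
rewrite mulr_natr -sumr_const; apply: ler_sum => y yB.
apply: le_trans (fL y yB); rewrite -sum1_card ler_nat.
by under [leqRHS]eq_bigl do rewrite inE.
Qed.

Lemma card_ord_diam (R : realDomainType) (K : nat) (S : {set 'I_K}) (L : R) :
  0 <= L -> {in S &, forall a b : 'I_K, (a : nat)%:R - (b : nat)%:R <= L} ->
  #|S|%:R <= L + 1.
Proof.
move=> L0 SL; have [->|[x xS]] := set_0Vmem S; first by rewrite cards0 addr_ge0.
pose m := [arg min_(a < x in S) (a : nat)].
pose M := [arg max_(a > x in S) (a : nat)].
have [mS mP] : m \in S /\ forall a, a \in S -> (m <= a)%N.
  by rewrite /m; case: arg_minnP.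
have [MS MP] : M \in S /\ forall a, a \in S -> (a <= M)%N.
  by rewrite /M; case: arg_maxnP.
have cS : (#|S| <= (M - m).+1)%N.
  rewrite cardE -(size_map val) -(size_iota m (M - m).+1).
  apply: uniq_leq_size; first by rewrite (map_inj_uniq val_inj) enum_uniq.
  move=> _ /mapP[a aS ->]; rewrite mem_enum in aS.
  by rewrite mem_iota mP //= addnS ltnS subnKC ?MP // mP.
apply: (@le_trans _ _ (M - m).+1%:R); first by rewrite ler_nat.
by rewrite -natr1 lerD2r natrB ?mP // SL.
Qed.

Lemma dotB_erase (R : realType) (n K : nat) (z : 'I_K) (u : 'I_n -> R) i
    (q p : {ffun 'I_n -> 'I_K}) :
  erase z i q = erase z i p ->
  dot u q - dot u p = u i * ((q i)%:R - (p i)%:R).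
Proof.
move=> e; rewrite /dot -sumrB (bigD1 i) //= big1 ?addr0 -?mulrBr// => j ji.
by have /ffunP/(_ j) := e; rewrite !ffunE (negbTE ji) => ->; rewrite subrr.
Qed.

(** On a fibre of [erase z i] only the coordinate [i] varies, and [dot u] varies by [u i] times as
    much. As [dot u] stays in an interval of length [2 * c], that coordinate stays in one of length
    [2 * c / w]. *)
Lemma card_slab (R : realType) (n K : nat) (z : 'I_K) (u : 'I_n -> R) i
    (A B : {set {ffun 'I_n -> 'I_K}}) (b c w : R) :
  0 < w -> w <= `|u i| -> 0 <= c ->
  (forall q, q \in A -> `|dot u q - b| <= c) ->
  (forall q, q \in A -> erase z i q \in B) ->
  #|A|%:R <= (2 * c / w + 1) * #|B|%:R.
Proof.
move=> w0 wu c0 Ac AB; apply: (card_le_fiber AB) => y _.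
set F := [set x in A | _]%SET.
have Finj : {in F &, injective (fun q : {ffun 'I_n -> 'I_K} => q i)}.
  move=> q p; rewrite !inE => /andP[_ /eqP qy] /andP[_ /eqP py] qpi.
  apply/ffunP => j; have [->//|ji] := eqVneq j i.
  by move: qy; rewrite -py => /ffunP/(_ j); rewrite !ffunE (negbTE ji).
rewrite -(card_in_imset Finj); apply: card_ord_diam.
  by rewrite divr_ge0 ?mulr_ge0 // ltW.
move=> _ _ /imsetP[q qF ->] /imsetP[p pF ->].
move: qF pF; rewrite !inE => /andP[qA /eqP qy] /andP[pA /eqP py].
have e := @dotB_erase R n K z u i q p (etrans qy (esym py)).
rewrite ler_pdivlMr // mulrC.
apply: le_trans (_ : `|dot u q - dot u p| <= _).
  rewrite e normrM.
  apply: le_trans (_ : w * `|(q i)%:R - (p i)%:R| <= _).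
    by rewrite ler_wpM2l ?ler_norm // ltW.
  by rewrite ler_wpM2r.
have -> : dot u q - dot u p = (dot u q - b) - (dot u p - b) by ring.
apply: (le_trans (ler_normB _ _)).
by have := Ac _ qA; have := Ac _ pA; lra.
Qed.

Lemma card_slab1 (R : realType) (n K : nat) (u : 'I_n -> R) i
    (A : {set {ffun 'I_n -> 'I_K}}) (b c : R) :
  u i = 1 -> 0 <= c -> (forall q, q \in A -> `|dot u q - b| <= c) ->
  #|A|%:R <= (2 * c + 1) * K%:R ^+ n.-1.
Proof.
move=> ui c0 Ac; have [->|[x xA]] := set_0Vmem A.
  by rewrite cards0 mulr_ge0 ?exprn_ge0 ?addr_ge0 ?mulr_ge0.
(* [z] is read off a point of [A], because ['I_K] may be empty. *)
pose z := x i; pose B := [set q | q \in pffun_on z (predC1 i) predT]%SET.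
have cB : #|B| = (K ^ n.-1)%N.
  by rewrite cardsE card_pffun_on cardC1 card_ord /= card_ord.
rewrite -natrX -cB -[2 * c]divr1.
apply: (@card_slab _ _ _ z u i A B b) => // [|q _]; first by rewrite ui normr1.
rewrite inE; apply/pffun_onP; split => //; apply/fintype.subsetP => j.
by rewrite !inE ffunE; case: (j == i); rewrite ?eqxx.
Qed.

(** [card_slab] is applied twice. Since [v i = 0], erasing the coordinate [i] by means of [u] leaves
    [dot v] unchanged, so the second constraint survives and controls the coordinate [j]. *)
Lemma card_slab2 (R : realType) (n K : nat) (u v : 'I_n -> R) i j
    (A : {set {ffun 'I_n -> 'I_K}}) (b b' c c' w : R) :
  u i = 1 -> v i = 0 -> 0 < w -> w <= `|v j| -> 0 <= c -> 0 <= c' ->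
  (forall q, q \in A -> `|dot u q - b| <= c) ->
  (forall q, q \in A -> `|dot v q - b'| <= c') ->
  #|A|%:R <= (2 * c + 1) * ((2 * c' / w + 1) * K%:R ^+ n.-2).
Proof.
move=> ui vi w0 wv c0 c'0 Au Av; have [->|[x xA]] := set_0Vmem A.
  by rewrite cards0 !(mulr_ge0, exprn_ge0, addr_ge0) ?invr_ge0 // ltW.
have ij : i != j.
  by apply: contraL wv => /eqP <-; rewrite vi normr0 -ltNge.
pose z := x i; pose B := (erase z i @: A)%SET.
pose C := [set q | q \in pffun_on z (predC (pred2 i j)) predT]%SET.
have cC : #|C| = (K ^ n.-2)%N.
  rewrite cardsE card_pffun_on /= card_ord; congr (_ ^ _)%N.
  have := cardC (pred2 i j); rewrite card2 ij card_ord.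
  by move=> /(congr1 (fun k => k.-2)).
apply: le_trans (_ : (2 * c / 1 + 1) * #|B|%:R <= _).
  apply: (@card_slab _ _ _ z u i A B b) => // [|q qA]; first by rewrite ui normr1.
  exact: imset_f.
rewrite divr1; apply: ler_wpM2l; first by rewrite addr_ge0 ?mulr_ge0.
rewrite -natrX -cC; apply: (@card_slab _ _ _ z v j B C b') => //.
- move=> _ /imsetP[q qA ->]; have -> // : dot v (erase z i q) = dot v q.
  + apply/eqP; rewrite -subr_eq0 (@dotB_erase _ _ _ z _ i) ?vi ?mul0r //.
    by apply/ffunP => k; rewrite !ffunE; case: (k == i).
  + exact: Av.
- move=> _ /imsetP[q qA ->]; rewrite inE; apply/pffun_onP; split => //.
  apply/fintype.subsetP => k; rewrite !inE !ffunE.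
  by case: (k == j); case: (k == i); rewrite ?eqxx.
Qed.

(** * Strips of cells and their intersections *)

Lemma dotB_le (R : realType) (n K : nat) (w : 'I_n -> R)
    (q p : {ffun 'I_n -> 'I_K}) (c : R) :
  (forall j, `|w j| <= c) -> `|dot w q - dot w p| <= n%:R * (c * K%:R).
Proof.
move=> wc; rewrite /dot -sumrB; apply: (le_trans (ler_norm_sum _ _ _)).
apply: le_trans (_ : \sum_(j < n) c * K%:R <= _); last first.
  by rewrite mulr_natl sumr_const card_ord.
apply: ler_sum => j _; rewrite -mulrBr normrM; apply: ler_pM => //.
have qK : (q j : nat)%:R <= K%:R :> R by rewrite ler_nat ltnW.
have pK : (p j : nat)%:R <= K%:R :> R by rewrite ler_nat ltnW.
have q0 : 0 <= (q j : nat)%:R :> R by [].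
have p0 : 0 <= (p j : nat)%:R :> R by [].
by rewrite ler_norml; apply/andP; split; lra.
Qed.

(* A plane of equation [u . y = b] with [|u j| <= 1], in units of the cell side,
   only meets cells of the strip of half-width [n]. *)
Definition strip (R : realType) (n K : nat) (u : 'I_n -> R) (b : R) :
    {set {ffun 'I_n -> 'I_K}} :=
  [set q | `|dot u q - b| <= n%:R]%SET.

(* The difference of the two normals, projected along the coordinate [i], has
   size at least of order [D / K], where [D] is the distance from the point [k]
   of the second strip to the first plane; the strips then meet in a set cut
   out by two constraints that are independent at scale [K / D]. *)
Lemma card_stripI (R : realType) (n K : nat) (u u' : 'I_n -> R) i i' (b b' : R)
    (k : {ffun 'I_n -> 'I_K}) : (2 <= n)%N ->
  u i = 1 -> (forall j, `|u j| <= 1) -> u' i' = 1 -> (forall j, `|u' j| <= 1) ->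
  k \in strip K u' b' ->
  #|(strip K u b :&: strip K u' b')%SET|%:R <=
    (2 * n%:R + 1) * (66 * n%:R ^+ 2) * K%:R ^+ n.-1 / (1 + `|dot u k - b|).
Proof.
move=> n2 ui u1 ui' u'1; rewrite inE => kb'.
pose D : R := `|dot u k - b|; rewrite -/D.
have D0 : 0 <= D by exact: normr_ge0.
have D1 : 0 <= 1 + D by lra.
set A := (_ :&: _)%SET.
have Ab q : q \in A -> `|dot u q - b| <= n%:R by rewrite !inE => /andP[].
have Ab' q : q \in A -> `|dot u' q - b'| <= n%:R by rewrite !inE => /andP[].
have n2R : 2 <= n%:R :> R by rewrite ler_nat.
have K0 : (0 < K)%N by case: (K) (k i) => // -[].
have K1 : 1 <= K%:R :> R by rewrite ler1n.
have Kn0 : 0 <= K%:R ^+ n.-1 :> R by rewrite exprn_ge0.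
have n1 : 0 <= 2 * n%:R + 1 :> R by lra.
have C0 : 0 <= (2 * n%:R + 1) * (66 * n%:R ^+ 2) :> R.
  by rewrite (mulr_ge0 n1) // mulr_ge0 // exprn_ge0.
have nn : 2 * n%:R <= n%:R ^+ 2 :> R by rewrite expr2; apply: ler_wpM2r => //; lra.
rewrite ler_pdivlMr; last by lra.
(* For small [D] the bound for a single strip suffices, since [1 + 8 * n <= 66 * n ^ 2]. *)
have [D8|D8] := leP D (8 * n%:R).
  apply: le_trans (ler_wpM2r D1 (card_slab1 ui (ler0n R n) Ab)) _.
  rewrite mulrAC; apply: ler_wpM2r => //; apply: (ler_wpM2l n1).
  lra.
have [A0|[q qA]] := set_0Vmem A.
  by rewrite A0 cards0 mul0r; apply: mulr_ge0.
(* A common cell [q] bounds [D]; this later absorbs the [+ 1] of [card_slab2]. *)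
have DnK : D <= 2 * n%:R * K%:R.
  have e : D <= `|dot u k - dot u q| + `|dot u q - b|.
    by rewrite /D -[dot u k - b](subrKA (dot u q)) ler_normD.
  have h := @dotB_le _ _ _ u k q 1 u1; have h' := Ab _ qA; nra.
(* The second normal, with its coordinate [i] eliminated by the first, as [card_slab2] requires. *)
pose w j := u' j - u' i * u j.
have dotw p : dot w p = dot u' p - u' i * dot u p.
  by rewrite /dot mulr_sumr -sumrB; apply: eq_bigr => j _; rewrite /w; ring.
have wi : w i = 0 by rewrite /w ui mulr1 subrr.
have Aw p : p \in A -> `|dot w p - (b' - u' i * b)| <= 2 * n%:R.
  move=> pA; rewrite dotw.
  have -> : dot u' p - u' i * dot u p - (b' - u' i * b) =
            (dot u' p - b') - u' i * (dot u p - b) by ring.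
  apply: (le_trans (ler_normB _ _)); rewrite normrM.
  have := Ab _ pA; have := Ab' _ pA; have := u'1 i => h1 h2 h3.
  have := normr_ge0 (dot u p - b); have := normr_ge0 (u' i); nra.
have [j wj] : exists j, D / (8 * n%:R * K%:R) <= `|w j|.
  have [u'i|u'i] := leP (1 / 2) `|u' i|; last first.
    exists i'; rewrite /w ui' ler_pdivrMr; last by nra.
    have : 1 / 2 <= `|1 - u' i * u i'|.
      have : `|u' i * u i'| <= 1 / 2.
        by rewrite normrM; have := u1 i'; have := normr_ge0 (u i'); nra.
      have := ler_norm (1 - u' i * u i'); have := ler_norm (u' i * u i'); lra.
    nra.
  (* If all [w j] were smaller, [dot w] would differ by at most [D / 8] between [k] and [q]. But it
     is within [2 * n] of the central value at [q] and at least [D / 2 - n] away from it at [k],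
     which would give [D <= 8 * n]. *)
  apply: contrapT => /forallNP wlt.
  have : `|dot w k - dot w q| <= D / 8.
    have -> : D / 8 = n%:R * (D / (8 * n%:R * K%:R) * K%:R).
      by field; rewrite !pnatr_eq0 -!lt0n K0 (ltnW n2).
    by apply: dotB_le => j; apply/ltW; rewrite ltNge; apply/negP/wlt.
  have := Aw _ qA.
  have : `|u' i| * D - n%:R <= `|dot w k - (b' - u' i * b)|.
    rewrite dotw.
    have -> : dot u' k - u' i * dot u k - (b' - u' i * b) =
            (dot u' k - b') - u' i * (dot u k - b) by ring.
    rewrite /D -normrM distrC; apply: le_trans (lerB_dist _ _).
    by rewrite lerD2l lerN2.
  have e : `|dot w k - (b' - u' i * b)| <=
      `|dot w k - dot w q| + `|dot w q - (b' - u' i * b)|.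
    by rewrite -[dot w k - _](subrKA (dot w q)) ler_normD.
  nra.
set om := D / _ in wj.
have om0 : 0 < om by rewrite divr_gt0 //; nra.
have n0 : 0 <= 2 * n%:R :> R by lra.
apply: le_trans (ler_wpM2r D1 (card_slab2 ui wi om0 wj (ler0n R n) n0 Ab Aw)) _.
rewrite -!mulrA; apply: (ler_wpM2l n1).
have -> : K%:R ^+ n.-1 = K%:R * K%:R ^+ n.-2 :> R.
  by rewrite -exprS; congr (_ ^+ _); case: (n) n2 => [|[]].
have Kn20 : 0 <= K%:R ^+ n.-2 :> R by rewrite exprn_ge0.
rewrite !mulrA mulrAC; apply: ler_wpM2r => //.
(* The numerator is at most [33 * n ^ 2 * K], and [1 + D <= 2 * D] doubles 33 to 66. *)
have -> : 2 * 2 * n%:R / om + 1 = (32 * n%:R ^+ 2 * K%:R + D) / D :> R.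
  rewrite /om; field; rewrite !pnatr_eq0 -!lt0n K0 (ltnW n2) /=.
  by rewrite gt_eqF //; lra.
rewrite mulrAC ler_pdivrMr; last by lra.
have : 32 * n%:R ^+ 2 * K%:R + D <= 33 * n%:R ^+ 2 * K%:R :> R by nra.
have : 0 <= n%:R ^+ 2 * K%:R :> R by nra.
nra.
Qed.

(** * Ingredients of the L^2 argument *)

(** The points are grouped by the integer part [m] of their distance to the plane. Each group lies
    in two slabs of half-width 1/2, one on either side, with at most [2 * K ^ n.-1] points each. *)
Lemma sum_inv_dist (R : realType) (n K M : nat) (u : 'I_n -> R) i (b : R)
    (A : {set {ffun 'I_n -> 'I_K}}) :
  u i = 1 -> (forall k, k \in A -> `|dot u k - b| < M.+1%:R) ->
  \sum_(k in A) (1 + `|dot u k - b|)^-1 <=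
    4 * K%:R ^+ n.-1 * \sum_(m < M.+1) m.+1%:R^-1.
Proof.
move=> ui AM.
(* On [A] the truncation is below [M.+1], so [inord] does not alter it. *)
pose f (k : {ffun 'I_n -> 'I_K}) : 'I_M.+1 := inord (Num.truncn `|dot u k - b|).
rewrite (partition_big f predT) //= mulr_sumr; apply: ler_sum => m _.
have fm k : k \in A -> f k == m ->
    m%:R <= `|dot u k - b| /\ `|dot u k - b| <= m%:R + 1.
  move=> kA /eqP <-; rewrite /f.
  have /andP[h1 h2] := truncn_itv (normr_ge0 (dot u k - b)).
  rewrite inordK; last by rewrite -(ltr_nat R); apply: le_lt_trans (AM _ kA).
  by rewrite natr1; split=> //; exact: ltW.
apply: le_trans (_ : \sum_(k in A | f k == m) m.+1%:R^-1 <= _).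
  apply: ler_sum => k /andP[kA km]; have [h _] := fm k kA km.
  rewrite lef_pV2 ?posrE ?ltr_pwDl // -natr1; lra.
rewrite sumr_const -[X in X <= _]mulr_natl; apply: ler_wpM2r; first by rewrite invr_ge0.
have slab_half (c : R) :
    #|[set k : {ffun 'I_n -> 'I_K} | `|dot u k - c| <= 1 / 2]%SET|%:R <=
      2 * K%:R ^+ n.-1 :> R.
  have h0 : 0 <= 1 / 2 :> R by lra.
  have e : 2 * (1 / 2) + 1 = 2 :> R by lra.
  by rewrite -[in leRHS]e; apply: (card_slab1 (b := c) ui h0) => q; rewrite inE.
pose A1 := [set k : {ffun 'I_n -> 'I_K} | `|dot u k - (b + m%:R + 1/2)| <= 1 / 2]%SET.
pose A2 := [set k : {ffun 'I_n -> 'I_K} | `|dot u k - (b - m%:R - 1/2)| <= 1 / 2]%SET.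
have c1 : #|A1|%:R <= 2 * K%:R ^+ n.-1 :> R by exact: slab_half.
have c2 : #|A2|%:R <= 2 * K%:R ^+ n.-1 :> R by exact: slab_half.
apply: (@le_trans _ _ (#|A1|%:R + #|A2|%:R)); last by lra.
rewrite -natrD ler_nat; apply: leq_trans (leq_card_setU A1 A2).
apply: subset_leq_card; apply/fintype.subsetP => k; rewrite unfold_in => /andP[kA km].
have [] := fm k kA km; rewrite !inE.
case: (ger0P (dot u k - b)) => h h1 h2; apply/orP; [left|right];
  rewrite ler_norml; apply/andP; split; lra.
Qed.

(** Doubling the range adds [2 ^ l] terms, each at most [1 / 2 ^ l]. *)
Lemma harmonic_exp2 (R : realType) (l : nat) :
  \sum_(m < 2 ^ l) m.+1%:R^-1 <= l.+1%:R :> R.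
Proof.
elim: l => [|l IH]; first by rewrite big_ord1 invr1.
rewrite expnS mul2n -addnn big_split_ord /= -natr1; apply: lerD => //.
apply: le_trans (_ : \sum_(m < 2 ^ l) (2 ^ l)%:R^-1 <= _).
  apply: ler_sum => m _; rewrite lef_pV2 ?posrE ?ltr0n ?expn_gt0 //.
  by rewrite ler_nat leqW // leq_addr.
by rewrite sumr_const card_ord -[leLHS]mulr_natl divff // pnatr_eq0 -lt0n expn_gt0.
Qed.

(* Cauchy-Schwarz applied to the multiplicity function [r] of the family [Y]. *)
Lemma card_union_ge (R : realType) (J Q : finType) (A : {set J}) (X : {set Q})
    (Y : J -> {set Q}) (l L : R) :
  0 <= l -> 0 <= L ->
  (forall j, j \in A -> Y j \subset X) ->
  (forall j, j \in A -> l <= #|Y j|%:R) ->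
  (forall j, j \in A -> \sum_(k in A) #|Y j :&: Y k|%SET%:R <= L) ->
  #|A|%:R * l ^+ 2 <= #|X|%:R * L.
Proof.
move=> l0 L0 YX Yl YL.
pose r q : R := \sum_(j in A) (q \in Y j)%:R.
pose S := \sum_(q in X) r q.
have cardE1 (B : {set Q}) : B \subset X -> #|B|%:R = \sum_(q in X) (q \in B)%:R :> R.
  move=> BX; rewrite -sum1_card natr_sum [RHS](big_setID B) /=.
  rewrite [X in _ = _ + X]big1 ?addr0; last first.
    by move=> q; rewrite inE => /andP[/negbTE -> _].
  by rewrite (finset.setIidPr BX); apply: eq_bigr => q ->.
have SE : S = \sum_(j in A) #|Y j|%:R.
  rewrite /S /r exchange_big /=; apply: eq_bigr => j jA.
  by rewrite cardE1 ?YX.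
have S2 : S ^+ 2 <= #|X|%:R * \sum_(q in X) r q ^+ 2.
  have [/eqP X0|X0] := eqVneq #|X| 0%N.
    by move: X0; rewrite cards_eq0 => /eqP X0; rewrite /S X0 !big_set0 expr2 !mulr0.
  have Xp : 0 < #|X|%:R :> R by rewrite ltr0n lt0n.
  (* Cauchy-Schwarz is obtained from the squared deviations of [r] from its mean [S / #|X|],
     rescaled by [#|X|]. *)
  have : 0 <= \sum_(q in X) (#|X|%:R * r q - S) ^+ 2.
    by apply: sumr_ge0 => q _; exact: sqr_ge0.
  have -> : \sum_(q in X) (#|X|%:R * r q - S) ^+ 2 =
      #|X|%:R * (#|X|%:R * (\sum_(q in X) r q ^+ 2) - S ^+ 2).
    under eq_bigr do rewrite sqrrB exprMn.
    rewrite big_split /= sumrB -mulr_sumr sumr_const -[S ^+ 2 *+ _]mulr_natl.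
    have -> : \sum_(q in X) #|X|%:R * r q * S *+ 2 = #|X|%:R * S ^+ 2 *+ 2.
      by rewrite sumrMnl -mulr_suml -mulr_sumr -/S expr2 mulrA.
    by ring.
  by rewrite pmulr_rge0 // subr_ge0.
(* Double counting: [r q ^+ 2] is the number of ordered pairs of members of the family that both
   contain [q]. *)
have r2 : \sum_(q in X) r q ^+ 2 <= #|A|%:R * L.
  have -> : \sum_(q in X) r q ^+ 2 =
      \sum_(j in A) \sum_(k in A) #|Y j :&: Y k|%SET%:R.
    under eq_bigr do rewrite expr2 /r mulr_suml.
    rewrite exchange_big /=; apply: eq_bigr => j jA.
    under eq_bigr do rewrite mulr_sumr.
    rewrite exchange_big /=; apply: eq_bigr => k kA.
    rewrite cardE1 ?finset.subIset ?YX //; apply: eq_bigr => q _.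
    by rewrite inE -natrM mulnb.
  by rewrite mulr_natl -sumr_const; apply: ler_sum.
have lS : #|A|%:R * l <= S by rewrite SE mulr_natl -sumr_const; apply: ler_sum.
have [A0|A0] := eqVneq #|A| 0%N; first by rewrite A0 mul0r mulr_ge0.
have Ap : 0 < #|A|%:R :> R by rewrite ltr0n lt0n.
rewrite -(ler_pM2l Ap) mulrA -expr2 -exprMn.
apply: le_trans (_ : S ^+ 2 <= _).
  by rewrite lerXn2r ?nnegrE ?(le_trans _ lS) ?mulr_ge0.
apply: (le_trans S2); rewrite mulrCA; exact: ler_wpM2l.
Qed.

(** * Hyperplanes and the cells they meet *)

(** A basis of the direction has rank less than [n], so its cokernel has a nonzero column, which is
    a normal. Dividing by the entry of largest absolute value gives [u i = 1] and [|u j| <= 1], so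
    that later bounds are uniform over all planes. *)
Lemma affine_plane_eq (R : realType) (n : nat) (H : set 'rV[R]_n) :
  (0 < n)%N -> affine_plane n.-1 H ->
  exists (u : 'I_n -> R) (i : 'I_n) (b : R),
    [/\ u i = 1, forall j, `|u j| <= 1
      & forall y, H y -> \sum_(j < n) u j * y 0 j = b].
Proof.
move=> n0 [p [V [dV ->]]].
pose A : 'M[R]_(\dim V, n) := \matrix_i (vbasis V)`_i.
have C0 : cokermx A != 0.
  rewrite -mxrank_eq0 mxrank_coker -lt0n subn_gt0.
  by apply: leq_ltn_trans (rank_leq_row A) _; rewrite dV prednK.
have [i0 [j0 ij0]] : exists i j, cokermx A i j != 0.
  apply: contrapT => H0; case/eqP: C0; apply/matrixP => i j; rewrite [RHS]mxE.
  by apply: contrapT => /eqP ij; apply: H0; exists i, j.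
pose c j := cokermx A j j0.
pose i := [arg max_(k > i0) `|c k|]%O.
have ci k : `|c k| <= `|c i|.
  by rewrite /i; case: Order.TotalTheory.arg_maxP => //= m _; apply.
have ci0 : c i != 0.
  by rewrite -normr_gt0; apply: lt_le_trans (ci i0); rewrite normr_gt0.
exists (fun j => c j / c i), i, (\sum_(j < n) (c j / c i) * p 0 j); split.
- by rewrite divff.
- by move=> j; rewrite normrM normfV ler_pdivrMr ?normr_gt0 // mul1r.
move=> _ [v vV <-]; under eq_bigr do rewrite mxE mulrDr.
rewrite big_split /=; apply/eqP; rewrite -subr_eq0 addrAC subrr add0r; apply/eqP.
have cb (k : 'I_(\dim V)) : \sum_(j < n) c j * (vbasis V)`_k 0 j = 0.
  have /matrixP/(_ k j0) := mulmx_coker A; rewrite mxE [RHS]mxE => e.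
  rewrite -[RHS]e.
  by apply: eq_bigr => j _; rewrite mxE mulrC.
under eq_bigr do rewrite mulrAC.
rewrite -mulr_suml [X in X / _](_ : _ = 0) ?mul0r //.
rewrite (coord_vbasis vV); under eq_bigr do rewrite summxE mulr_sumr.
rewrite exchange_big /= big1 // => k _.
under eq_bigr do rewrite mxE mulrCA.
by rewrite -mulr_sumr cb mulr0.
Qed.

Definition box (R : realType) (n rho : nat) : set 'rV[R]_n :=
  [set y | forall i, - rho%:R <= y 0 i < rho%:R].

(* Cells have side 1 / N and tile [-rho, rho)^n; they are indexed from the corner
   (-rho, ..., -rho). *)
Definition in_cell (R : realType) (n rho N : nat)
    (q : {ffun 'I_n -> 'I_(2 * rho * N)}) (y : 'rV[R]_n) : Prop :=
  forall i, (q i)%:R <= (y 0 i + rho%:R) * N%:R < (q i).+1%:R.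

Definition cells (R : realType) (n rho N : nat) (A : set 'rV[R]_n) :
    {set {ffun 'I_n -> 'I_(2 * rho * N)}} :=
  [set q | `[< exists2 y, A y & in_cell q y >]]%SET.

Lemma cellsP (R : realType) (n rho N : nat) (A : set 'rV[R]_n) q :
  reflect (exists2 y, A y & in_cell q y) (q \in cells rho N A).
Proof. by rewrite inE; exact: asboolP. Qed.

Lemma cellsS (R : realType) (n rho N : nat) (A B : set 'rV[R]_n) :
  A `<=` B -> cells rho N A \subset cells rho N B.
Proof.
move=> AB; apply/fintype.subsetP => q /cellsP[y yA qy].
by apply/cellsP; exists y => //; exact: AB.
Qed.

Lemma box_in_cell (R : realType) (n rho N : nat) (y : 'rV[R]_n) :
  (0 < N)%N -> box rho y -> exists q : {ffun 'I_n -> 'I_(2 * rho * N)}, in_cell q y.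
Proof.
move=> N0 yb.
have N0R : 0 < N%:R :> R by rewrite ltr0n.
have h i : exists a : 'I_(2 * rho * N),
    (a : nat)%:R <= (y 0 i + rho%:R) * N%:R < a.+1%:R.
  have /andP[y1 y2] := yb i.
  have y0 : 0 <= (y 0 i + rho%:R) * N%:R by rewrite mulr_ge0 //; lra.
  have /andP[t1 t2] := truncn_itv y0.
  have tK : (Num.truncn ((y 0 i + rho%:R) * N%:R)%R < 2 * rho * N)%N.
    rewrite -(ltr_nat R); apply: le_lt_trans t1 _.
    by rewrite !natrM ltr_pM2r //; lra.
  by exists (Ordinal tK); rewrite /= t1.
have /choice[f fP] := h.
by exists [ffun i => f i] => i; rewrite ffunE.
Qed.

(** In units of the cell side, a point is within 1 of the corner of its cell in each coordinate. The
    term with [rho] appears because cells are indexed from the corner of the box. *)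
Lemma in_cell_strip (R : realType) (n rho N : nat) (u : 'I_n -> R) (b : R)
    (q : {ffun 'I_n -> 'I_(2 * rho * N)}) (y : 'rV[R]_n) :
  (forall j, `|u j| <= 1) -> \sum_(j < n) u j * y 0 j = b -> in_cell q y ->
  q \in strip _ u (N%:R * (b + rho%:R * \sum_(j < n) u j)).
Proof.
move=> u1 <- qy; rewrite inE mulr_sumr -big_split /= mulr_sumr /dot -sumrB.
apply: (le_trans (ler_norm_sum _ _ _)).
apply: le_trans (_ : \sum_(j < n) 1 <= _); last by rewrite sumr_const card_ord.
apply: ler_sum => j _.
have -> : u j * (q j)%:R - N%:R * (u j * y 0 j + rho%:R * u j) =
    u j * ((q j)%:R - (y 0 j + rho%:R) * N%:R) by ring.
rewrite normrM -[leRHS]mulr1; apply: ler_pM => //.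
have /andP[] := qy j; rewrite -natr1 => h1 h2.
by rewrite ler_norml; apply/andP; split; lra.
Qed.

(** The left side bounds the distance, in cell sides, from any cell to a plane meeting the box; a
    power of 2 above it makes the harmonic sum linear in [k]. *)
Lemma exp2_bound (n rho k : nat) :
  (2 * n * (2 * rho * 2 ^ k) < 2 ^ (k + 4 * n * rho))%N.
Proof.
have : (4 * n * rho < 2 ^ (4 * n * rho))%N by exact: ltn_expl.
set m := (4 * n * rho)%N => mlt; rewrite expnD.
have -> : (2 * n * (2 * rho * 2 ^ k) = 2 ^ k * m)%N by rewrite /m; ring.
by rewrite ltn_pmul2l ?expn_gt0.
Qed.

(** One plane is chosen for each cell of [G], and [card_union_ge] is applied to the cells of its
    slice of [B]. For a fixed plane, [card_stripI] bounds the intersections by inverse distances,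
    which [sum_inv_dist] and [harmonic_exp2] add up. *)
Lemma card_cells_planes (R : realType) (n rho k : nat) (B G : set 'rV[R]_n)
    (l : R) : (2 <= n)%N -> 0 <= l ->
  (forall x, G x -> exists H, [/\ affine_plane n.-1 H, H x
     & l <= #|cells rho (2 ^ k) (B `&` H)|%:R]) ->
  #|cells rho (2 ^ k) G|%:R * l ^+ 2 <= #|cells rho (2 ^ k) B|%:R *
    (4 * ((2 * n%:R + 1) * (66 * n%:R ^+ 2)) *
     ((2 * rho * 2 ^ k)%:R ^+ n.-1) ^+ 2 * (k + 4 * n * rho).+1%:R).
Proof.
move=> n2 l0 GH; set K := (2 * rho * 2 ^ k)%N.
pose C : R := (2 * n%:R + 1) * (66 * n%:R ^+ 2); rewrite -/C.
have n0 : (0 < n)%N by exact: ltnW.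
have C0 : 0 <= C by rewrite !(mulr_ge0, addr_ge0, exprn_ge0).
have /choice[f fP] : forall q : {ffun 'I_n -> 'I_K},
    exists f : ('I_n -> R) * 'I_n * R * {set {ffun 'I_n -> 'I_K}},
    q \in cells rho (2 ^ k) G ->
    [/\ f.1.1.1 f.1.1.2 = 1, forall j, `|f.1.1.1 j| <= 1,
        q \in strip _ f.1.1.1 f.1.2 &
        [/\ f.2 \subset strip _ f.1.1.1 f.1.2, l <= #|f.2|%:R
          & f.2 \subset cells rho (2 ^ k) B]].
  move=> q; have [qG|_] := boolP (q \in _); last first.
    (* A dummy value for the cells that miss [G]. *)
    by exists (fun=> 0, Ordinal n0, 0, finset.set0).
  have /cellsP[x xG qx] := qG.
  have [H [aH Hx lH]] := GH x xG.
  have [u [i [b [ui u1 uH]]]] := affine_plane_eq n0 aH.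
  exists (u, i, (2 ^ k)%:R * (b + rho%:R * \sum_(j < n) u j),
    cells rho (2 ^ k) (B `&` H)) => _; split => //=.
    by apply: in_cell_strip qx => //; exact: uH.
  split => //; last exact: cellsS.
  apply/fintype.subsetP => p /cellsP[y [_ Hy] py].
  by apply: in_cell_strip py => //; exact: uH.
apply: (@card_union_ge _ _ _ _ _ (fun q => (f q).2)) => //.
- by rewrite !(mulr_ge0, exprn_ge0).
- by move=> q /fP[_ _ _ []].
- by move=> q /fP[_ _ _ []].
move=> q qG; have [ui u1 qs [Ys _ _]] := fP q qG.
set u := (f q).1.1.1 in ui u1 qs Ys; set b := (f q).1.2 in qs Ys.
set i := (f q).1.1.2 in ui.
have K0 : (0 < K)%N by case: (K) (q i) => // -[].
pose D (p : {ffun 'I_n -> 'I_K}) : R := `|dot u p - b|.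
(* The plane of [q] is fixed; [D p] measures how far the cell [p], which lies in the strip of its
   own plane, is from it. *)
apply: le_trans (_ : \sum_(p in cells rho (2 ^ k) G)
    C * K%:R ^+ n.-1 * (1 + D p)^-1 <= _).
  apply: ler_sum => p pG; have [vi v1 ps [Zs _ _]] := fP p pG.
  have h := card_stripI b n2 ui u1 vi v1 ps.
  apply: le_trans h.
  by rewrite ler_nat; apply: subset_leq_card; exact: finset.setISS.
rewrite -mulr_sumr.
have El : (2 ^ (k + 4 * n * rho) = (2 ^ (k + 4 * n * rho)).-1.+1)%N.
  by rewrite prednK // expn_gt0.
have Db p : p \in cells rho (2 ^ k) G -> D p < (2 ^ (k + 4 * n * rho)).-1.+1%:R.
  move=> _; rewrite -El.
  apply: le_lt_trans (_ : (2 * n * K)%:R < _); last first.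
    by rewrite ltr_nat; exact: exp2_bound.
  have e : D p <= `|dot u p - dot u q| + `|dot u q - b|.
    by rewrite /D -[dot u p - b](subrKA (dot u q)) ler_normD.
  have h := @dotB_le _ _ _ u p q 1 u1; rewrite inE in qs.
  have K1 : 1 <= K%:R :> R by rewrite ler1n.
  have nK : n%:R <= n%:R * K%:R :> R by rewrite ler_peMr.
  have -> : (2 * n * K)%:R = 2 * (n%:R * K%:R) :> R by rewrite mulrA -!natrM.
  rewrite mul1r -/K in h; lra.
have := sum_inv_dist ui Db; rewrite -El => /(@ler_wpM2l _ (C * K%:R ^+ n.-1)) h.
apply: (le_trans (h _)); first by rewrite mulr_ge0 ?exprn_ge0.
have -> : 4 * C * (K%:R ^+ n.-1) ^+ 2 * (k + 4 * n * rho).+1%:R =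
  C * K%:R ^+ n.-1 * (4 * K%:R ^+ n.-1 * (k + 4 * n * rho).+1%:R) by ring.
apply: ler_wpM2l; first by rewrite mulr_ge0 ?exprn_ge0.
apply: ler_wpM2l; first by rewrite mulr_ge0 ?exprn_ge0.
exact: harmonic_exp2.
Qed.

(** * Covering numbers from packings *)

Lemma coord_le_eucl_dist (R : realType) (n : nat) (x y : 'rV[R]_n) i :
  `|x 0 i - y 0 i| <= eucl_dist x y.
Proof.
rewrite -sqrtr_sqr; apply: ler_wsqrtr; rewrite (bigD1 i) //= lerDl.
by apply: sumr_ge0 => j _; exact: sqr_ge0.
Qed.

Lemma eucl_dist_in_cell (R : realType) (n rho N : nat) (x y : 'rV[R]_n)
    (q : {ffun 'I_n -> 'I_(2 * rho * N)}) :
  (0 < N)%N -> in_cell q x -> in_cell q y -> eucl_dist x y <= n%:R / N%:R.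
Proof.
move=> N0 qx qy; have N0R : 0 < N%:R :> R by rewrite ltr0n.
have nN0 : 0 <= n%:R / N%:R :> R by rewrite divr_ge0.
rewrite -(ger0_norm nN0) -sqrtr_sqr; apply: ler_wsqrtr.
apply: le_trans (_ : \sum_(i < n) N%:R^-1 ^+ 2 <= _).
  apply: ler_sum => i _; rewrite -[X in X <= _]real_normK ?num_real //.
  rewrite lerXn2r ?nnegrE ?invr_ge0 //.
  rewrite -(ler_pM2r N0R) mulVf ?gt_eqF // -[X in _ * X](gtr0_norm N0R) -normrM.
  have /andP[] := qx i; have /andP[] := qy i; rewrite -natr1 => h1 h2 h3 h4.
  by rewrite ler_norml; apply/andP; split; lra.
rewrite sumr_const card_ord -[leLHS]mulr_natl exprMn; apply: ler_wpM2r.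
  exact: sqr_ge0.
by rewrite -natrX ler_nat; case: (n) => // m; rewrite expnS expn1 leq_pmulr.
Qed.

(** Two points with a common neighbour at distance [N^-1] differ by at most two cell sides per
    coordinate, so their indices differ by less than 4 and congruence makes them equal. Hence balls
    of radius [N^-1] centred in distinct cells of one class modulo 4 are disjoint. *)
Lemma in_cell_sep (R : realType) (n rho N : nat) (x y z : 'rV[R]_n)
    (p q : {ffun 'I_n -> 'I_(2 * rho * N)}) :
  (0 < N)%N -> in_cell p x -> in_cell q y ->
  (forall i, p i = q i %[mod 4]) ->
  eucl_dist x z <= N%:R^-1 -> eucl_dist y z <= N%:R^-1 -> p = q.
Proof.
move=> N0 px qy pq xz yz; apply/ffunP => i; apply: val_inj => /=.
have N0R : 0 < N%:R :> R by rewrite ltr0n.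
have : `|x 0 i - y 0 i| <= 2 / N%:R.
  have := coord_le_eucl_dist x z i; have := coord_le_eucl_dist y z i.
  rewrite distrC; have := ler_normD (x 0 i - z 0 i) (z 0 i - y 0 i).
  have -> : x 0 i - z 0 i + (z 0 i - y 0 i) = x 0 i - y 0 i by ring.
  lra.
rewrite ler_pdivlMr // -[X in _ * X](gtr0_norm N0R) -normrM ler_norml.
move=> /andP[h1 h2].
have /andP[] := px i; have /andP[] := qy i; rewrite -!natr1 => h3 h4 h5 h6.
have a1 : (p i < q i + 4)%N by rewrite -(ltr_nat R) natrD; lra.
have a2 : (q i < p i + 4)%N by rewrite -(ltr_nat R) natrD; lra.
by move: (pq i) a1 a2; clear; lia.
Qed.

(** The cells are split into [4 ^ n] classes by their indices modulo 4. One point of [B] in each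
    cell of a class gives a packing by balls of radius [N^-1], whose sum is at most 1. *)
Lemma card_cells_packing (R : realType) (n rho N : nat) (s delta : R)
    (B : set 'rV[R]_n) :
  (packing_delta s delta B <= 1)%E -> (0 < N)%N -> N%:R^-1 <= delta ->
  #|cells rho N B|%:R * (2 / N%:R) `^ s <= 4%:R ^+ n.
Proof.
move=> PB N0 Nd; have N0R : 0 < N%:R :> R by rewrite ltr0n.
have w0 : 0 < (2 / N%:R) `^ s by rewrite powR_gt0 // divr_gt0.
rewrite -ler_pdivlMr // mulrC.
pose f (q : {ffun 'I_n -> 'I_(2 * rho * N)}) : {ffun 'I_n -> 'I_4} :=
  [ffun i => inord (q i %% 4)].
have -> : 4%:R ^+ n = #|[set: {ffun 'I_n -> 'I_4}]%SET|%:R :> R.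
  by rewrite cardsT card_ffun !card_ord natrX.
apply: (card_le_fiber (f := f)) => [q|c _]; first by rewrite inE.
set F := [set x in _ | _]%SET.
have [->|[q0 q0F]] := set_0Vmem F; first by rewrite cards0 invr_ge0 ltW.
have /choice[y yP] : forall q, exists y : 'rV[R]_n,
    q \in cells rho N B -> B y /\ in_cell q y.
  move=> q; have [/cellsP[y By qy]|_] := boolP (q \in _); last by exists 0.
  by exists y.
have FB q : q \in F -> q \in cells rho N B by rewrite inE => /andP[].
pose q_ k := nth q0 (enum F) k.
have q_F k : (k < #|F|)%N -> q_ k \in F.
  by move=> kF; rewrite -mem_enum mem_nth // -cardE.
have : (\esum_(i in `I_#|F|) ((2 * N%:R^-1) `^ s)%:E <= 1)%E.
  apply: le_trans PB; apply: ereal_sup_ubound.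
  exists `I_#|F|, (fun k => y (q_ k)), (fun=> N%:R^-1); split => //.
    move=> k kF; split; first by have [] := yP _ (FB _ (q_F _ kF)).
    by rewrite invr_gt0 N0R.
  move=> j k jF kF [z [jz kz]].
  have [Bj qj] := yP _ (FB _ (q_F _ jF)); have [Bk qk] := yP _ (FB _ (q_F _ kF)).
  have : q_ j = q_ k.
    apply: (in_cell_sep N0 qj qk _ jz kz) => i.
    move: (q_F _ jF) (q_F _ kF); rewrite !inE => /andP[_ /eqP jc] /andP[_ /eqP].
    rewrite -jc => /ffunP/(_ i); rewrite !ffunE => /(congr1 val) /=.
    by rewrite !inordK ?ltn_mod.
  move=> /eqP; rewrite nth_uniq ?enum_uniq -?cardE //; first by move/eqP.
rewrite esum_fset; [|exact: finite_II|by move=> i _; rewrite lee_fin powR_ge0].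
rewrite -fsbig_ord sumEFin sumr_const card_ord lee_fin -[leLHS]mulr_natl.
by move=> h; rewrite -[leRHS]mul1r ler_pdivlMr.
Qed.

(** * Null sets of the packing measure *)

Lemma packing_delta_ge0 (R : realType) (n : nat) (s delta : R)
    (A : set 'rV[R]_n) : (0 <= packing_delta s delta A)%E.
Proof.
apply: ereal_sup_ubound; exists set0, (fun=> 0), (fun=> 0); split => //.
exact/esym/esum_set0.
Qed.

Lemma packing_premeasure_ge0 (R : realType) (n : nat) (s : R)
    (A : set 'rV[R]_n) : (0 <= packing_premeasure s A)%E.
Proof.
by apply: le_ereal_inf_tmp => _ [delta _ <-]; exact: packing_delta_ge0.
Qed.

Lemma packing_measure_ge0 (R : realType) (n : nat) (s : R)
    (A : set 'rV[R]_n) : (0 <= packing_measure s A)%E.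
Proof.
apply: le_ereal_inf_tmp => _ [B [_ ->]].
by apply: esum_ge0 => i _; exact: packing_premeasure_ge0.
Qed.

(** A cover of total premeasure below 1 is enough: each piece then has packing sums at most 1 below
    some scale, which is what the cell counts use. *)
Lemma packing_measure0_cover (R : realType) (n : nat) (s : R)
    (E : set 'rV[R]_n) : packing_measure s E = 0%E ->
  exists B : nat -> set 'rV[R]_n, E `<=` \bigcup_i B i /\
    forall i, exists2 delta : R, 0 < delta & (packing_delta s delta (B i) <= 1)%E.
Proof.
move=> E0; have : (packing_measure s E < 1)%E by rewrite E0 lte_fin.
move=> /ereal_inf_lt[_ [B [EB ->]] B1]; exists B; split => // i.
have : (packing_premeasure s (B i) < 1)%E.
  apply: le_lt_trans B1; apply: esum_ge.
  exists [set i]; first by split => //; exact: finite_set1.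
  by rewrite fsbig_set1.
by move=> /ereal_inf_lt[_ [delta d0 <-] /ltW h]; exists delta.
Qed.

Lemma packing_measure0_bigcup (R : realType) (n : nat) (I : countType) (s : R)
    (A : set 'rV[R]_n) (G : I -> set 'rV[R]_n) :
  A `<=` \bigcup_i G i -> (forall i, packing_premeasure s (G i) = 0%E) ->
  packing_measure s A = 0%E.
Proof.
move=> AG G0; apply/eqP; rewrite eq_le packing_measure_ge0 andbT.
(* The indices that [unpickle] does not decode will carry the empty set. *)
have set0_0 : packing_premeasure s (set0 : set 'rV[R]_n) = 0%E.
  apply/eqP; rewrite eq_le packing_premeasure_ge0 andbT.
  apply: ge_ereal_inf; exists (packing_delta s 1 (set0 : set 'rV[R]_n)).
    by exists 1; rewrite /= ?ltr01.
  apply: ge_ereal_sup => _ [D [c [r [Dc _ ->]]]].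
  rewrite (_ : D = set0) ?esum_set0 //; apply/seteqP; split => // i /Dc[[]].
apply: ge_ereal_inf; exists 0%E => //.
exists (fun l => if unpickle l is Some i then G i else set0); split.
  move=> x /AG[i _ Gx]; exists (pickle i) => //; by rewrite pickleK.
by rewrite esum1 // => l _; case: unpickle.
Qed.

Lemma packing_measureS (R : realType) (n : nat) (s : R) (A B : set 'rV[R]_n) :
  A `<=` B -> packing_measure s B = 0%E -> packing_measure s A = 0%E.
Proof.
move=> AB B0; apply/eqP; rewrite eq_le packing_measure_ge0 andbT -B0.
apply: ereal_inf_le_tmp => _ [C [BC ->]]; exists C; split => //.
exact: subset_trans AB BC.
Qed.

(** * Packing premeasure from covering numbers *)

Lemma natr_exp2_powR (R : realType) (k : nat) (a : R) :
  (2 ^ k)%:R `^ a = (2 `^ a) ^+ k.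
Proof.
by rewrite natrX -powR_mulrn // -powRrM mulrC powRrM powR_mulrn // powR_ge0.
Qed.

Lemma powR_inv (R : realType) (x a : R) : 0 <= x -> x^-1 `^ a = (x `^ a)^-1.
Proof. by move=> x0; rewrite -powR_inv1 // -powRrM mulN1r powRN. Qed.

Lemma powR2_lt (R : realType) (a b : R) : a < b -> 2 `^ a < 2 `^ b :> R.
Proof.
by move=> ab; rewrite /powR pnatr_eq0 /= ltr_expR ltr_pM2r // ln_gt0 // ltr1n.
Qed.

Lemma dyadic_scale (R : realType) (r : R) : 0 < r -> r <= 1 ->
  exists k, (2 ^ k.+1)%:R^-1 < r /\ r <= (2 ^ k)%:R^-1.
Proof.
move=> r0 r1; pose m := Num.truncn r^-1.
have /andP[m1 m2] : m%:R <= r^-1 < m.+1%:R by rewrite truncn_itv ?invr_ge0 ?ltW.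
have m0 : (0 < m)%N.
  by rewrite -ltnS -(ltr_nat R); apply: le_lt_trans m2; rewrite invf_ge1.
have /andP[k1 k2] := trunc_log_bounds (isT : 1 < 2)%N m0.
exists (trunc_log 2 m); split.
  rewrite -[ltRHS]invrK ltf_pV2 ?posrE ?invr_gt0 ?ltr0n ?expn_gt0 //.
  by apply: lt_le_trans m2 _; rewrite ler_nat.
rewrite -[leLHS]invrK lef_pV2 ?posrE ?invr_gt0 ?ltr0n ?expn_gt0 //.
by apply: le_trans m1; rewrite ler_nat.
Qed.

Lemma geometric_sum_le (R : realType) (x : R) (a b : nat) : 0 <= x -> x < 1 ->
  \sum_(a <= k < b) x ^+ k <= x ^+ a / (1 - x).
Proof.
move=> x0 x1; rewrite ler_pdivlMr ?subr_gt0 //.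
have [ab|ba] := leqP a b; last by rewrite big_geq ?mul0r ?exprn_ge0 // ltnW.
rewrite mulr_suml.
under eq_bigr do rewrite mulrBr mulr1 -exprSr -[_ - _]opprB.
by rewrite sumrN telescope_sumr // opprB gerBl exprn_ge0.
Qed.

(** Cells of side [2 ^ - (k + n.+1)] have diameter at most [n] times that, hence at most
    [2 ^ - k.+1]. *)
Lemma leq_mul_exp2 (n k : nat) : (n * 2 ^ k.+1 <= 2 ^ (k + n.+1))%N.
Proof.
have n2 : (n <= 2 ^ n)%N by apply: ltnW; exact: ltn_expl.
rewrite addnS -addSn expnD mulnC.
by apply: leq_mul.
Qed.

(* The centres of disjoint balls of radius about [2 ^ - k] lie in distinct
   cells of side [2 ^ - (k + n.+1)]. *)
Lemma card_packing_scale (R : realType) (n rho k : nat) (G : set 'rV[R]_n)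
    s (c : nat -> 'rV[R]_n) (r : nat -> R) :
  G `<=` box rho -> uniq s ->
  (forall i, i \in s -> G (c i) /\ (2 ^ k.+1)%:R^-1 < r i) ->
  (forall i j, i \in s -> j \in s ->
     closed_eball (c i) (r i) `&` closed_eball (c j) (r j) !=set0 -> i = j) ->
  (size s <= #|cells rho (2 ^ (k + n.+1)) G|)%N.
Proof.
move=> Gb us sG sI; set N := (2 ^ (k + n.+1))%N.
have N0 : (0 < N)%N by rewrite expn_gt0.
case: (pselect (exists i, i \in s)) => [[i0 i0s]|s0]; last first.
  by case: s {us sG sI} s0 => // i s []; exists i; rewrite inE eqxx.
have [q0 _] := box_in_cell N0 (Gb _ (proj1 (sG _ i0s))).
have /choice[q qP] : forall i, exists q : {ffun 'I_n -> 'I_(2 * rho * N)},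
    i \in s -> in_cell q (c i).
  move=> i; have [/sG[Gc _]|_] := boolP (i \in s); last by exists q0.
  by have [q qc] := box_in_cell N0 (Gb _ Gc); exists q.
(* If two centres share a cell, the second lies in both balls. *)
have qI : {in s &, injective q}.
  move=> i j si sj qij; apply: sI => //; exists (c j).
  have [Gi ri] := sG _ si; have [Gj rj] := sG _ sj.
  have r0 a : (2 ^ k.+1)%:R^-1 < r a -> 0 < r a.
    by apply: lt_trans; rewrite invr_gt0 ltr0n expn_gt0.
  split; last first.
    rewrite /closed_eball /= /eucl_dist big1 ?sqrtr0 ?ltW ?r0 // => l _.
    by rewrite subrr expr0n.
  apply: le_trans (ltW ri).
  have qj := qP _ sj; rewrite -qij in qj.
  apply: (le_trans (eucl_dist_in_cell N0 (qP _ si) qj)).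
  rewrite ler_pdivrMr ?ltr0n // mulrC ler_pdivlMr ?ltr0n ?expn_gt0 // -natrM ler_nat.
  exact: leq_mul_exp2.
rewrite -(size_map q) -(card_uniqP _); last by rewrite map_inj_in_uniq.
apply: subset_leq_card; apply/fintype.subsetP => _ /mapP[i si ->].
by apply/cellsP; exists (c i); [have [] := sG _ si | exact: qP].
Qed.

(** The balls of a packing are sorted by the dyadic size of their radius. The cell count bounds the
    number at scale [k], so their contribution is at most [C' * x ^+ k] with
    [x = 2 ^ (tau - t) < 1]; restricting to small radii leaves a tail of a geometric series. *)
Lemma packing_premeasure0_cells (R : realType) (n rho k0 : nat) (t tau C : R)
    (G : set 'rV[R]_n) :
  G `<=` box rho -> 0 <= t -> tau < t ->
  (forall k, (k0 <= k)%N -> #|cells rho (2 ^ k) G|%:R <= C * (2 ^ k)%:R `^ tau) ->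
  packing_premeasure t G = 0%E.
Proof.
move=> Gb t0 taut GC; apply/eqP; rewrite eq_le packing_premeasure_ge0 andbT.
have C0 : 0 <= C.
  have := GC _ (leqnn k0); have p0 : 0 < (2 ^ k0)%:R `^ tau :> R.
    by rewrite powR_gt0 // ltr0n expn_gt0.
  by move=> h; rewrite -(pmulr_lge0 _ p0); apply: le_trans h.
pose x : R := 2 `^ tau / 2 `^ t.
have x0 : 0 <= x by rewrite divr_ge0 ?powR_ge0.
have x1 : x < 1 by rewrite ltr_pdivrMr ?powR_gt0 // mul1r powR2_lt.
pose C' := C * (2 `^ tau) ^+ n.+1 * 2 `^ t.
have C'0 : 0 <= C' by rewrite !mulr_ge0 ?exprn_ge0 ?powR_ge0.
apply/lee_addgt0Pr => e e0; rewrite add0e.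
have [k1 k01 xk1] : exists2 k1, (k0 <= k1)%N & C' * (x ^+ k1 / (1 - x)) <= e.
  have : `|x| < 1 by rewrite ger0_norm.
  (* The divisor is [C' + 1] because [C'] may vanish. *)
  move=> /cvg_expr/cvgr0Pnorm_lt /(_ (e * (1 - x) / (C' + 1))) [].
    by rewrite divr_gt0 ?mulr_gt0 ?subr_gt0 // ltr_pwDr.
  move=> M _ MP; exists (maxn k0 M); first exact: leq_maxl.
  have /ltW := MP (maxn k0 M) (leq_maxr k0 M).
  rewrite /= ger0_norm ?exprn_ge0 // ler_pdivlMr ?ltr_pwDr // => h.
  rewrite mulrA ler_pdivrMr ?subr_gt0 //; apply: le_trans h.
  rewrite mulrC; apply: ler_wpM2l; first exact: exprn_ge0.
  by rewrite lerDl.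
apply: ge_ereal_inf; exists (packing_delta t (2 ^ k1)%:R^-1 G).
  by exists (2 ^ k1)%:R^-1 => //=; rewrite invr_gt0 ltr0n expn_gt0.
apply: ge_ereal_sup => _ [D [c [r [Dc Dd ->]]]].
apply: ge_ereal_sup => _ [X [finX XD] <-].
rewrite fsbig_finite //= sumEFin lee_fin; set s : seq nat := finmap.enum_fset _.
have sD i : i \in s -> D i.
  by move=> si; apply: XD; apply: set_mem; rewrite -(in_fset_set finX).
have k1_1 : (2 ^ k1)%:R^-1 <= 1 :> R by rewrite invf_le1 ?ltr0n ?ler1n ?expn_gt0.
have /choice[ka kaP] : forall i, exists k, i \in s ->
    [/\ (k1 <= k)%N, (2 ^ k.+1)%:R^-1 < r i & r i <= (2 ^ k)%:R^-1].
  move=> i; have [si|_] := boolP (i \in s); last by exists 0%N.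
  have [_ /andP[r0 rk1]] := Dc _ (sD _ si).
  have [k [kr rk]] := dyadic_scale r0 (le_trans rk1 k1_1).
  exists k => _; split => //.
  have := lt_le_trans kr rk1; rewrite ltf_pV2 ?posrE ?ltr0n ?expn_gt0 //.
  by rewrite ltr_nat ltn_exp2l.
pose M := \max_(i <- s) ka i.
have kaM i : i \in s -> (ka i < M.+1)%N.
  by move=> si; rewrite ltnS; exact: leq_bigmax_seq.
apply: le_trans (_ : \sum_(k1 <= k < M.+1) C' * x ^+ k <= _); last first.
  rewrite -mulr_sumr; apply: le_trans xk1; apply: ler_wpM2l => //.
  exact: geometric_sum_le.
(* Each ball is written as a sum over scales with the single term [k = ka i], so that the two sums
   can be exchanged. *)
apply: le_trans (_ : \sum_(i <- s) \sum_(k1 <= k < M.+1 | ka i == k)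
    (2 * (2 ^ k)%:R^-1) `^ t <= _).
  rewrite !big_seq; apply: ler_sum => i si; have [h1 h2 h3] := kaP _ si.
  rewrite [leRHS]big_mkcond /=.
  rewrite (bigD1_seq (ka i)) ?iota_uniq ?mem_index_iota ?h1 ?kaM //= eqxx /=.
  apply: ler_wpDr; first by apply: sumr_ge0 => k _; case: ifP; rewrite ?powR_ge0.
  have [_ /andP[r0 _]] := Dc _ (sD _ si).
  apply: ge0_ler_powR => //; rewrite ?nnegrE ?mulr_ge0 ?invr_ge0 ?(ltW r0) //.
  by apply: ler_wpM2l.
rewrite (exchange_big_dep xpredT) //= big_seq [leRHS]big_seq; apply: ler_sum => k.
rewrite mem_index_iota => /andP[k1k _].
rewrite -big_filter big_const_seq count_predT iter_addr_0.
set sk := [seq i <- s | _].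
have skP i : i \in sk -> i \in s /\ ka i = k.
  by rewrite mem_filter => /andP[/eqP -> ->].
have size_sk : (size sk <= #|cells rho (2 ^ (k + n.+1)) G|)%N.
  apply: (@card_packing_scale _ n rho k G sk c r Gb).
  - by rewrite filter_uniq // finmap.fset_uniq.
  - move=> i /skP[si <-]; have [_ h _] := kaP _ si; split => //.
    by have [] := Dc _ (sD _ si).
  - by move=> i j /skP[/sD Di _] /skP[/sD Dj _]; exact: Dd.
rewrite -[leLHS]mulr_natl.
apply: le_trans (_ : C * (2 ^ (k + n.+1))%:R `^ tau * (2 * (2 ^ k)%:R^-1) `^ t <= _).
  apply: ler_wpM2r; first exact: powR_ge0.
  apply: le_trans (GC _ (leq_trans k01 (leq_trans k1k (leq_addr _ _)))).
  by rewrite ler_nat.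
rewrite powRM ?invr_ge0 // powR_inv //.
rewrite !natr_exp2_powR exprD /C' /x exprMn exprVn.
rewrite [X in X <= _](_ : _ = C * (2 `^ tau) ^+ n.+1 * 2 `^ t *
  ((2 `^ tau) ^+ k * ((2 `^ t) ^+ k)^-1)) //.
by ring.
Qed.

(** * Hausdorff measure from covering numbers *)

Lemma hausdorff_premeasure_ge0 (R : realType) (n : nat) (s delta : R)
    (A : set 'rV[R]_n) : (0 <= hausdorff_premeasure s delta A)%E.
Proof.
apply: le_ereal_inf_tmp => _ [D [U [_ _ ->]]].
by apply: esum_ge0 => i _; exact: poweR_ge0.
Qed.

Lemma hausdorff_premeasure_le_cover (R : realType) (n : nat) (T : countType)
    (s delta : R) (A : set 'rV[R]_n) (P : set T) (U : T -> set 'rV[R]_n) :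
  A `<=` \bigcup_(i in P) U i -> (forall i, P i -> (diam (U i) <= delta%:E)%E) ->
  (hausdorff_premeasure s delta A <= \esum_(i in P) (diam (U i) `^ s))%E.
Proof.
move=> AU Ud; apply: ereal_inf_lbound.
pose V p := if unpickle p is Some i then U i else set0.
have VE i : V (pickle i) = U i by rewrite /V pickleK.
exists (pickle @` P), V; split.
- by move=> x /AU[i Pi Ux]; exists (pickle i); [exists i | rewrite VE].
- by move=> _ [i Pi <-]; rewrite VE; exact: Ud.
- rewrite esum_image; last by move=> i j _ _; exact: (pcan_inj pickleK).
  by apply: eq_esum => i _; rewrite VE.
Qed.

Lemma esum_geometric_le (R : realType) (I : countType) (e : R) : 0 <= e ->
  (\esum_(i in [set: I]) (e / (2 ^ (pickle i).+1)%:R)%:E <= e%:E)%E.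
Proof.
move=> e0; pose a k : \bar R := (e / (2 ^ k.+1)%:R)%:E.
have a0 k : (0 <= a k)%E by rewrite lee_fin divr_ge0.
rewrite -(@esum_image _ _ _ [set: I] pickle a); last first.
  by move=> i j _ _; exact: (pcan_inj pickleK).
pose P : pred nat := fun k => `[< range (@pickle I) k >].
rewrite (_ : range _ = [set k | P k]); last first.
  by apply/seteqP; split => k /asboolP.
by rewrite -nneseries_esum //; exact: epsilon_trick0.
Qed.

(** Each piece [A i] is cut along cells of its own side [1 / N i], and its contribution fits a
    summable share of [e]. *)
Lemma hausdorff_premeasure_cells (R : realType) (n : nat) (I : countType)
    (rho N : I -> nat) (s delta e : R) (W : set 'rV[R]_n) (A : I -> set 'rV[R]_n) :
  0 <= s -> 0 <= e -> W `<=` \bigcup_i A i -> (forall i, A i `<=` box (rho i)) ->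
  (forall i, [/\ (0 < N i)%N, n%:R / (N i)%:R <= delta
   & #|cells (rho i) (N i) (A i)|%:R * (n%:R / (N i)%:R) `^ s <=
     e / (2 ^ (pickle i).+1)%:R]) ->
  (hausdorff_premeasure s delta W <= e%:E)%E.
Proof.
move=> s0 e0 WA Ab H.
pose P : set (I * nat) := [set: I] `*`` (fun i => `I_#|cells (rho i) (N i) (A i)|).
(* Cells are designated by their rank in the enumeration, since their type depends on the piece. *)
pose U (p : I * nat) : set 'rV[R]_n :=
  [set y | A p.1 y /\ exists q : {ffun 'I_n -> 'I_(2 * rho p.1 * N p.1)},
     in_cell q y /\ index q (enum (cells (rho p.1) (N p.1) (A p.1))) = p.2].
have Ud p : (diam (U p) <= (n%:R / (N p.1)%:R)%:E)%E.
  have [N0 _ _] := H p.1.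
  apply: ge_ereal_sup => _ [x [Ax [q [qx qi]]] [y [Ay [q' [qy qi']]] <-]].
  have xc z a : A p.1 z -> in_cell a z -> a \in enum (cells (rho p.1) (N p.1) (A p.1)).
    by move=> Az az; rewrite mem_enum; apply/cellsP; exists z.
  have qq : q = q'.
    by rewrite -(nth_index q (xc x q Ax qx)) qi -qi' nth_index // (xc y).
  by rewrite lee_fin; apply: (eucl_dist_in_cell N0 qx); rewrite qq.
apply: le_trans (@hausdorff_premeasure_le_cover _ _ _ s delta W P U _ _) _.
- move=> x /WA[i _ Ax]; have [N0 _ _] := H i.
  have [q qx] := box_in_cell N0 (Ab i _ Ax).
  exists (i, index q (enum (cells (rho i) (N i) (A i)))).
    split => //=; rewrite cardE index_mem mem_enum; apply/cellsP.
    by exists x.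
  by split => //=; exists q.
- move=> p _; apply: le_trans (Ud p) _.
  by have [_ Nd _] := H p.1; rewrite lee_fin.
rewrite -(@esum_esum _ _ _ _ _ (fun i k => (diam (U (i, k)) `^ s)%E)); last first.
  by move=> i k _ _; exact: poweR_ge0.
apply: le_trans (esum_geometric_le I e0); apply: le_esum => i _.
have [N0 _ NI] := H i.
apply: le_trans (_ : \esum_(k in `I_#|cells (rho i) (N i) (A i)|)
    ((n%:R / (N i)%:R) `^ s)%:E <= _)%E.
  apply: le_esum => k kI; rewrite -poweR_EFin.
  have [q qk qc] : exists2 q, index q (enum (cells (rho i) (N i) (A i))) = k
      & q \in cells (rho i) (N i) (A i).
    have : (0 < #|cells (rho i) (N i) (A i)|)%N by exact: leq_ltn_trans kI.
    move=> /card_gt0P[q0 _]; exists (nth q0 (enum (cells (rho i) (N i) (A i))) k).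
      by rewrite index_uniq ?enum_uniq -?cardE.
    by rewrite -mem_enum mem_nth -?cardE.
  (* Only ranks of cells that meet [A i] are used, so the diameter is not [-oo] and the power is
     monotone. *)
  have d0 : (0 <= diam (U (i, k)))%E.
    have /cellsP[y Ay qy] := qc.
    apply: le_trans (_ : (eucl_dist y y)%:E <= _)%E; first by rewrite lee_fin sqrtr_ge0.
    have Uy : U (i, k) y by split => //; exists q.
    by apply: ereal_sup_ubound; exists y => //; exists y.
  by apply: gt0_ler_poweR => //; rewrite ?in_itv /= ?leey ?d0 // ?lee_fin ?divr_ge0.
rewrite esum_fset; [|exact: finite_II|by move=> k _; rewrite lee_fin powR_ge0].
by rewrite -fsbig_ord sumEFin sumr_const card_ord lee_fin -[leLHS]mulr_natl.
Qed.

(** A Hausdorff cover may mix scales, so each piece only needs some good scale beyond every [m].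
    Contrapositively, a set of positive measure has a piece with many cells at all scales beyond
    some [m]. *)
Lemma hausdorff_measure0_cells (R : realType) (n : nat) (I : countType)
    (rho : I -> nat) (s : R) (W : set 'rV[R]_n) (A : I -> set 'rV[R]_n) :
  0 <= s -> W `<=` \bigcup_i A i -> (forall i, A i `<=` box (rho i)) ->
  (forall i m, exists2 k, (m <= k)%N &
    #|cells (rho i) (2 ^ k) (A i)|%:R <= (2 ^ k)%:R `^ s / m.+1%:R) ->
  hausdorff_measure s W = 0%E.
Proof.
move=> s0 WA Ab H; apply/eqP; rewrite eq_le; apply/andP; split; last first.
  apply: le_trans (hausdorff_premeasure_ge0 s 1 W) _.
  by apply: ereal_sup_ubound; exists 1; rewrite //= ltr01.
apply: ge_ereal_sup => _ [delta /= d0 <-]; apply/lee_addgt0Pr => e e0.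
rewrite add0e.
have /choice[k kP] : forall i, exists k, n%:R / (2 ^ k)%:R <= delta /\
    #|cells (rho i) (2 ^ k) (A i)|%:R * (n%:R / (2 ^ k)%:R) `^ s <=
      e / (2 ^ (pickle i).+1)%:R.
  move=> i; set e' := e / _; have e'0 : 0 < e' by rewrite divr_gt0 ?ltr0n ?expn_gt0.
  (* Beyond [m1] the cells have diameter at most [delta]; with [m2], the factor [m.+1^-1] brings the
     sum below [e']. *)
  pose m1 := Num.truncn (n%:R / delta); pose m2 := Num.truncn (n%:R `^ s / e').
  have [k mk kA] := H i (maxn m1 m2).
  have k0 : 0 < (2 ^ k)%:R :> R by rewrite ltr0n expn_gt0.
  exists k; split.
    rewrite ler_pdivrMr // mulrC -ler_pdivrMr //.
    have /andP[_ h] := truncn_itv (divr_ge0 (ler0n R n) (ltW d0)).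
    apply: (le_trans (ltW h)); rewrite ler_nat.
    apply: leq_trans (ltn_expl k (isT : 1 < 2)%N).
    by rewrite ltnS; apply: leq_trans mk; exact: leq_maxl.
  apply: (le_trans (ler_wpM2r (powR_ge0 _ _) kA)).
  have -> : (n%:R / (2 ^ k)%:R) `^ s = n%:R `^ s * ((2 ^ k)%:R `^ s)^-1.
    by rewrite powRM ?invr_ge0 // powR_inv.
  have p0 : (2 ^ k)%:R `^ s != 0 :> R by rewrite gt_eqF // powR_gt0.
  have -> : (2 ^ k)%:R `^ s / (maxn m1 m2).+1%:R * (n%:R `^ s * ((2 ^ k)%:R `^ s)^-1) =
     n%:R `^ s / (maxn m1 m2).+1%:R by rewrite [LHS]mulrC -mulrA mulKf.
  rewrite ler_pdivrMr ?ltr0n // mulrC -ler_pdivrMr //.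
  have /andP[_ h] := truncn_itv (divr_ge0 (powR_ge0 n%:R s) (ltW e'0)).
  by apply: (le_trans (ltW h)); rewrite ler_nat ltnS leq_maxr.
apply: (hausdorff_premeasure_cells s0 (ltW e0) WA Ab (N := fun i => (2 ^ k i)%N)) => i.
by have [h1 h2] := kP i; split => //; rewrite expn_gt0.
Qed.

(** * The dimension estimate *)

(** With [l = ln 2 * e], the power on the right is the exponential of [k * l], which is at least
    [1 + k * l]. This absorbs the logarithmic loss. *)
Lemma linear_le_exp2_powR (R : realType) (c : nat) (e : R) : 0 < e ->
  exists2 C : R, 0 <= C &
    forall k, (k + c).+1%:R <= C * (2 ^ k)%:R `^ e.
Proof.
move=> e0; pose l : R := ln 2 * e.
have l0 : 0 < l by rewrite mulr_gt0 ?ln_gt0 ?ltr1n.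
have C0 : 0 <= c.+1%:R + l^-1 :> R by rewrite addr_ge0 // invr_ge0 ltW.
exists (c.+1%:R + l^-1) => // k.
have h : 1 + k%:R * l <= (2 ^ k)%:R `^ e.
  rewrite natr_exp2_powR /powR pnatr_eq0 /= -expRM_natl.
  by apply: le_trans (expR_ge1Dx _); rewrite /l [ln 2 * e]mulrC.
apply: le_trans (ler_wpM2l C0 h).
have -> : (c.+1%:R + l^-1) * (1 + k%:R * l) =
   (k + c).+1%:R + (l^-1 + c.+1%:R * (k%:R * l)).
  by rewrite -addnS natrD; field; rewrite gt_eqF.
have l0' := ltW l0.
by rewrite lerDl addr_ge0 ?invr_ge0 // mulr_ge0 // mulr_ge0.
Qed.

Lemma box_exists (R : realType) (n : nat) (x : 'rV[R]_n) : exists rho, box rho x.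
Proof.
pose S : R := \sum_(i < n) `|x 0 i|.
have S0 : 0 <= S by apply: sumr_ge0.
have /andP[_ h] := truncn_itv S0.
exists (Num.truncn S).+1 => i.
have : `|x 0 i| <= S by rewrite /S (bigD1 i) //= lerDl; apply: sumr_ge0.
move=> /le_lt_trans /(_ h); rewrite ltr_norml => /andP[h1 h2].
by rewrite h2 ltW.
Qed.

Lemma box_subset (R : realType) (n rho rho' : nat) :
  (rho <= rho')%N -> (box rho : set 'rV[R]_n) `<=` box rho'.
Proof.
rewrite -(ler_nat R) => rr y yr i; have /andP[h1 h2] := yr i.
by apply/andP; split; lra.
Qed.

(** Neither the threshold nor the constant depends on [rho]: the packing bound concerns all of
    [B]. *)
Lemma card_cells_packing_powR (R : realType) (n : nat) (s delta : R)
    (B : set 'rV[R]_n) :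
  0 < delta -> (packing_delta s delta B <= 1)%E ->
  exists k0, forall rho k, (k0 <= k)%N ->
    #|cells rho (2 ^ k) B|%:R <= 4%:R ^+ n / 2 `^ s * (2 ^ k)%:R `^ s.
Proof.
move=> d0 Bd; exists (Num.truncn delta^-1) => rho k dk.
have k0 : 0 < (2 ^ k)%:R :> R by rewrite ltr0n expn_gt0.
have kd : (2 ^ k)%:R^-1 <= delta.
  rewrite -[leRHS]invrK lef_pV2 ?posrE ?invr_gt0 //.
  have /andP[_ /ltW h] : (Num.truncn delta^-1)%:R <= delta^-1 < (Num.truncn delta^-1).+1%:R.
    by rewrite truncn_itv // invr_ge0 ltW.
  apply: (le_trans h); rewrite ler_nat.
  by apply: leq_ltn_trans dk _; exact: ltn_expl.
have := card_cells_packing rho Bd (expn_gt0 2 k) kd.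
rewrite powRM ?invr_ge0 // powR_inv // mulrA -ler_pdivlMr ?invr_gt0 ?powR_gt0 //.
by rewrite invrK -ler_pdivlMr ?powR_gt0 // mulrAC.
Qed.

Lemma powRD3 (R : realType) (x a b : R) :
  0 < x -> x `^ (a + 3 * b) = x `^ a * (x `^ b) ^+ 3.
Proof.
move=> x0; rewrite powRD ?(gt_eqF x0) ?implybT //.
by rewrite [3 * b]mulrC powRrM powR_mulrn ?powR_ge0.
Qed.

(** With [Z = 2 ^ (k * n.-1)] and [w = 2 ^ (k * e)], the counting bound reads [NG * (Z / w) ^ 2 <=
    const * 2 ^ (k * s) * Z ^ 2 * w]. Two factors [w] come from the slices and one from the
    logarithm, whence the exponent [s + 3 * e]. *)
Lemma packing_premeasure_planes0 (R : realType) (n rho m : nat)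
    (s t e delta : R) (B : set 'rV[R]_n) : (2 <= n)%N ->
  0 <= s -> 0 < e -> s + 3 * e < t -> 0 < delta ->
  (packing_delta s delta B <= 1)%E ->
  packing_premeasure t (box rho `&` [set x | exists H, [/\ affine_plane n.-1 H,
    H x & forall k, (m <= k)%N ->
      (2 ^ k)%:R `^ (n.-1%:R - e) / m.+1%:R <=
        #|cells rho (2 ^ k) (B `&` H)|%:R]]) = 0%E.
Proof.
move=> n2 s0 e0 st d0 Bd; set G := _ `&` _.
have [k0 Bk] := card_cells_packing_powR d0 Bd.
have [C C0 Ck] := linear_le_exp2_powR (4 * n * rho) e0.
pose c : R := 4 * ((2 * n%:R + 1) * (66 * n%:R ^+ 2)) * ((2 * rho)%:R ^+ n.-1) ^+ 2.
have c0 : 0 <= c by rewrite !(mulr_ge0, addr_ge0, exprn_ge0).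
apply: (@packing_premeasure0_cells _ n rho (maxn m k0) t (s + 3 * e)
  (4%:R ^+ n / 2 `^ s * (c * C) * m.+1%:R ^+ 2)) => //.
- by move=> x [].
- by apply: le_trans (ltW st); rewrite addr_ge0 // mulr_ge0 // ltW.
move=> k; rewrite geq_max => /andP[mk k0k].
set y : R := (2 ^ k)%:R; have y0 : 0 < y by rewrite ltr0n expn_gt0.
pose Z := y ^+ n.-1; have Z0 : 0 < Z by rewrite exprn_gt0.
pose w := y `^ e; have w0 : 0 < w by rewrite powR_gt0.
have m0 : 0 < m.+1%:R :> R by [].
have lE : y `^ (n.-1%:R - e) = Z / w.
  by rewrite powRD ?(gt_eqF y0) ?implybT // powRN powR_mulrn // ltW.
have l0 := ltW (divr_gt0 (divr_gt0 Z0 w0) m0).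
have GH x : G x -> exists H, [/\ affine_plane n.-1 H, H x
    & Z / w / m.+1%:R <= #|cells rho (2 ^ k) (B `&` H)|%:R].
  move=> [_ [H [aH Hx Hk]]]; exists H; split => //.
  by rewrite -lE; exact: Hk.
have := card_cells_planes n2 l0 GH.
rewrite natrM -/y [(_ * y) ^+ _]exprMn -/Z.
set NG := #|_|%:R => h.
have sw : y `^ (s + 3 * e) = y `^ s * w ^+ 3 by exact: powRD3.
have h2 : NG * (Z / w / m.+1%:R) ^+ 2 <=
    (4%:R ^+ n / 2 `^ s * y `^ s) * (c * Z ^+ 2 * (C * w)).
  apply: (le_trans h).
  have -> : 4 * ((2 * n%:R + 1) * (66 * n%:R ^+ 2)) *
     ((2 * rho)%:R ^+ n.-1 * Z) ^+ 2 * (k + 4 * n * rho).+1%:R =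
     c * Z ^+ 2 * (k + 4 * n * rho).+1%:R by rewrite /c; ring.
  have cZ : 0 <= c * Z ^+ 2 by rewrite mulr_ge0 // exprn_ge0 // ltW.
  apply: ler_pM; [exact: ler0n| |exact: Bk|exact: (ler_wpM2l cZ)].
  by apply: (mulr_ge0 cZ); exact: ler0n.
have q0 : 0 < (Z / w / m.+1%:R) ^+ 2 by rewrite exprn_gt0 // !divr_gt0.
rewrite -(ler_pM2r q0); apply: (le_trans h2); rewrite sw le_eqVlt; apply/orP; left.
apply/eqP; field; rewrite !gt_eqF ?powR_gt0 //.
Qed.

Lemma packing_measure0_plane_extension (R : realType) (n : nat) (s t : R)
    (E : set 'rV[R]_n) : (2 <= n)%N ->
  0 <= s -> s < t -> packing_measure s E = 0%E ->
  packing_measure t (plane_extension E) = 0%E.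
Proof.
move=> n2 s0 st /packing_measure0_cover[B [EB Bd]].
(* The bound 1/2 keeps [n.-1 - e] nonnegative; the other one gives [s + 3 * e < t]. *)
pose e := Num.min (1 / 2) ((t - s) / 4).
have e0 : 0 < e by rewrite lt_min; apply/andP; split; lra.
have e12 : e <= 1 / 2 by rewrite ge_min lexx.
have est : s + 3 * e < t.
  have : e <= (t - s) / 4 by rewrite ge_min lexx orbT.
  lra.
have n1 : 1 <= n.-1%:R :> R by rewrite ler1n; case: (n) n2 => [|[]].
(* The flag separates the pieces of [E] itself from the unions of planes with uniformly large
   slices. *)
pose G (p : nat * nat * nat * bool) : set 'rV[R]_n :=
  let: (i, rho, m, b) := p in
  if b then box rho `&` B i else
  box rho `&` [set x | exists H, [/\ affine_plane n.-1 H,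
    H x & forall k, (m <= k)%N ->
      (2 ^ k)%:R `^ (n.-1%:R - e) / m.+1%:R <=
        #|cells rho (2 ^ k) (B i `&` H)|%:R]].
apply: (@packing_measure0_bigcup _ _ _ _ _ G); last first.
  move=> [[[i rho] m] b]; have [delta d0 Bdi] := Bd i; case: b => /=.
    have [k0 Bk] := card_cells_packing_powR d0 Bdi.
    apply: (@packing_premeasure0_cells _ n rho k0 t s (4%:R ^+ n / 2 `^ s)) => //.
      by apply: le_trans (ltW st).
    move=> k /(Bk rho); apply: le_trans; rewrite ler_nat.
    by apply: subset_leq_card; apply: cellsS => x [].
  exact: packing_premeasure_planes0 d0 Bdi.
move=> x [Ex|[H [aH dH] Hx]].
  have [i _ Bx] := EB _ Ex; have [rho bx] := box_exists x.
  by exists (i, rho, 0%N, true).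
(* All boxes used for the slices are enlarged by [r], so that they also contain [x]. *)
have [r bx] := box_exists x.
suff [i [rho [m im]]] : exists i rho m, forall k, (m <= k)%N ->
    (2 ^ k)%:R `^ (n.-1%:R - e) / m.+1%:R <=
      #|cells (rho + r) (2 ^ k) (B i `&` H)|%:R.
  exists (i, (rho + r)%N, m, false) => //; split; last by exists H.
  by apply: box_subset bx; exact: leq_addl.
(* Otherwise every piece of the slice has sparse scales beyond every [m], and [E] meets [H] in a set
   of dimension at most [n.-1 - e]. *)
apply: contrapT => Hn.
have ne0 : 0 <= n.-1%:R - e by lra.
have : hausdorff_measure (n.-1%:R - e) (E `&` H) = 0%E.
  apply: (@hausdorff_measure0_cells _ _ (nat * nat)%type (fun p => p.2 + r)%N _ _
    (fun p => B p.1 `&` H `&` box (p.2 + r)) ne0).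
  - move=> y [/EB[i _ By] Hy]; have [rho by_] := box_exists y.
    exists (i, rho) => //; split => //.
    by apply: box_subset by_; exact: leq_addr.
  - by move=> p y [].
  move=> [i rho] m /=; apply: contrapT => Hk; apply: Hn; exists i, rho, m => k mk.
  rewrite leNgt; apply/negP => lk; apply: Hk; exists k => //.
  apply: le_trans (ltW lk); rewrite ler_nat; apply: subset_leq_card.
  by apply: cellsS => y [].
move=> h0; have : (hausdorff_dim (E `&` H) <= (n.-1%:R - e)%:E)%E.
  by apply: ereal_inf_lbound; exists (n.-1%:R - e).
by rewrite dH lee_fin; lra.
Qed.

Theorem theorem5 (R : realType) (n : nat) (hn : (2 <= n)%N)
    (E : set 'rV[R]_n) :
  packing_dim (plane_extension E) = packing_dim E.
Proof.
apply/eqP; rewrite eq_le; apply/andP; split; last first.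
  apply: ereal_inf_le_tmp => _ [s [s0 Fs] <-]; exists s => //; split => //.
  by apply: packing_measureS Fs => x Ex; left.
(* An exponent [s] admissible for [E] makes every [s + e] admissible for the extension. *)
apply: le_ereal_inf_tmp => _ [s [s0 Es] <-]; apply/lee_addgt0Pr => e e0.
rewrite -EFinD; apply: ereal_inf_lbound; exists (s + e); last by [].
split; first by rewrite addr_ge0 // ltW.
by apply: packing_measure0_plane_extension Es; rewrite ?ltrDl.
Qed.
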